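(* Let $\mathcal{A}$, $\mathcal{A}_1$, $\Phi$ and $\{p_\alpha\}_\alpha$ be as described in the context. Let $N\ge2$, let $b_1,\dots,b_N$ be invertible elements of $\mathcal{A}_1$, let $\mathcal{F}$ be a proper, finitely invariant Furstenberg family of subsets of $\mathbb{N}$, and let $r_1,\dots,r_N\in\mathbb{N}$ satisfy $0<r_1<r_2<\dots<r_N$. For $1\le l\le N$ write $T_l:=T_{\Phi,b_l}$. Then the following are equivalent. (1) $T_1^{r_1},T_2^{r_2},\dots,T_N^{r_N}$ are disjoint $\mathcal{F}$-transitive on $\mathcal{A}$. (2) For every $p_\alpha$ there exist sequences $\{q_n\}_n$ and $\{d^{(1)}_n\}_n,\dots,\{d^{(N)}_n\}_n$ in $\mathcal{A}$ such that for every $\varepsilon>0$ there exists a set $F_\varepsilon\in\mathcal{F}$ such that for all $n\in F_\varepsilon$: (i) for all $1\le l\le N$, $$\|q_n-p_\alpha^2\|<\varepsilon,\qquad \|d^{(l)}_n-p_\alpha^2\|<\varepsilon,$$ $$\|\Phi^{-r_ln}(b_l)\Phi^{-r_ln+1}(b_l)\cdots\Phi^{-1}(b_l)\,q_n\|<\varepsilon,$$ $$\|\Phi^{r_ln-1}(b_l^{-1})\Phi^{r_ln-2}(b_l^{-1})\cdots\Phi(b_l^{-1})\,b_l^{-1}\,d^{(l)}_n\|<\varepsilon;$$ (ii) for all $l,s\in\{1,\dots,N\}$ with $l\ne s$, $$\|\Phi^{r_sn-r_ln}(b_l)\Phi^{r_sn-r_ln+1}(b_l)\cdots\Phi^{r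_sn-1}(b_l)\,\Phi^{r_sn-1}(b_s^{-1})\Phi^{r_sn-2}(b_s^{-1})\cdots\Phi(b_s^{-1})\,b_s^{-1}\,d^{(s)}_n\|<\varepsilon.$$
   Context: $\mathcal{A}$ is a non-unital $C^*$-algebra that is a closed two-sided ideal in a unital $C^*$-algebra $\mathcal{A}_1$. $\Phi$ is an isometric $*$-isomorphism of $\mathcal{A}_1$ onto itself with $\Phi(\mathcal{A})=\mathcal{A}$. There is a net $\{p_\alpha\}_\alpha\subset\mathcal{A}$ of self-adjoint elements with $\|p_\alpha\|\le1$ for all $\alpha$, such that $\{p_\alpha^2\}_\alpha$ is an approximate unit for $\mathcal{A}$, and such that for every $\alpha$ there exists $N_\alpha\in\mathbb{N}$ with $\Phi^n(p_\alpha)p_\alpha=0$ for all $n\ge N_\alpha$. For an invertible $b\in\mathcal{A}_1$, the generalized translation operator $T_{\Phi,b}$ on $\mathcal{A}_1$ is $T_{\Phi,b}(a)=b\,\Phi(a)$. It is invertible and satisfies $T_{\Phi,b}(\mathcal{A})=\mathcal{A}$, so it is regarded as an operator on $\mathcal{A}$. A Furstenberg family is a collection $\mathcal{F}$ of subsets of $\mathbb{N}$ such that $A\in\mathcal{F}$ and $A\subset B\subset\mathbb{N}$ imply $B\in\mathcal{F}$. It is proper if it is non-empty and does not contain the empty set, and finitely invariant if $A\setminus[0,n]\in\mathcal{F}$ for all $A\in\mathcal{F}$ and $n\ge0$. For $N\ge2$, bounded operators $S_1,\dots,S_N$ on a Banach space $X$ are disjoint $\mathcal{F}$-transitive if for all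 non-empty open sets $O,V_1,\dots,V_N\subset X$ the set $\{n\in\mathbb{N}:O\cap S_1^{-n}(V_1)\cap\cdots\cap S_N^{-n}(V_N)\ne\emptyset\}$ belongs to $\mathcal{F}$. *)

(* Defs.v *)
From HB Require Import structures.
From mathcomp Require Import all_boot all_order all_algebra.
From mathcomp Require Import complex.
From mathcomp Require Import all_classical all_reals all_analysis.

Set Implicit Arguments.
Unset Strict Implicit.
Unset Printing Implicit Defensive.

Import Order.TTheory GRing.Theory Num.Theory.
Import numFieldNormedType.Exports.

Local Open Scope classical_set_scope.
Local Open Scope ring_scope.

(* Hierarchy-Builder rejects a structure that inherits from both the normed
   modules and the rings of the library (they already have a join, NumDomain,
   where the norm takes values in the type itself).  So the product is added to
   the complete normed modules here, and the library's ring, algebra and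
   unit-ring structures are derived from it. *)
HB.mixin Record isBanachAlgebra (K : numFieldType) A
    & CompleteNormedModule K A := {
  bmul : A -> A -> A ;
  bone : A ;
  bmulA : associative bmul ;
  bmul1 : left_id bone bmul ;
  bmulr1 : right_id bone bmul ;
  bmulDl : left_distributive bmul +%R ;
  bmulDr : right_distributive bmul +%R ;
  bone_neq0 : bone != 0 ;
  bscaleAl : forall (c : K) (x y : A), c *: bmul x y = bmul (c *: x) y ;
  bscaleAr : forall (c : K) (x y : A), c *: bmul x y = bmul x (c *: y) ;
  bnorm_submul : forall x y : A, `|bmul x y| <= `|x| * `|y|
}.

#[short(type="banachAlgType")]
HB.structure Definition BanachAlgebra (K : numFieldType) :=
  {A of CompleteNormedModule K A & isBanachAlgebra K A}.

HB.instance Definition _ (K : numFieldType) (A : banachAlgType K) :=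
  GRing.Zmodule_isNzRing.Build (BanachAlgebra.sort A)
    bmulA bmul1 bmulr1 bmulDl bmulDr bone_neq0.

HB.instance Definition _ (K : numFieldType) (A : banachAlgType K) :=
  GRing.Lmodule_isLalgebra.Build K (BanachAlgebra.sort A) bscaleAl.

HB.instance Definition _ (K : numFieldType) (A : banachAlgType K) :=
  GRing.Lalgebra_isAlgebra.Build K (BanachAlgebra.sort A) bscaleAr.

Section BanachUnits.
Context {K : numFieldType} {A : banachAlgType K}.

Definition bunit : pred A := fun x => `[< exists y, y * x = 1 /\ x * y = 1 >].

Definition binv (x : A) : A :=
  if pselect (exists y, y * x = 1 /\ x * y = 1) is left e
  then projT1 (cid e) else x.

Lemma binvP (x : A) : bunit x -> binv x * x = 1 /\ x * binv x = 1.
Proof.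
by move=> /asboolP ux; rewrite /binv; case: pselect => // e; case: cid.
Qed.

Lemma bmulVr : {in bunit, left_inverse 1 binv *%R}.
Proof. by move=> x /binvP[]. Qed.

Lemma bdivrr : {in bunit, right_inverse 1 binv *%R}.
Proof. by move=> x /binvP[]. Qed.

Lemma bunitP (x y : A) : y * x = 1 /\ x * y = 1 -> bunit x.
Proof. by move=> xy; apply/asboolP; exists y. Qed.

Lemma binv_out : {in [predC bunit], binv =1 id}.
Proof.
by move=> x /asboolP nux; rewrite /binv; case: pselect => // /nux.
Qed.

End BanachUnits.

HB.instance Definition _ (K : numFieldType) (A : banachAlgType K) :=
  GRing.NzRing_hasMulInverse.Build (BanachAlgebra.sort A)
    bmulVr bdivrr bunitP binv_out.

(* Only instantiated with [K := R[i]] for [R : realType]. *)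
HB.mixin Record isCStarAlgebra (K : numClosedFieldType) A
    & BanachAlgebra K A := {
  star : A -> A ;
  starK : involutive star ;
  starD : {morph star : x y / x + y} ;
  starZ : forall (c : K) (x : A), star (c *: x) = c^* *: star x ;
  starM : forall x y : A, star (bmul x y) = bmul (star y) (star x) ;
  norm_cstar : forall x : A, `|bmul (star x) x| = `|x| ^+ 2
}.

#[short(type="cstarAlgType")]
HB.structure Definition CStarAlgebra (K : numClosedFieldType) :=
  {A of BanachAlgebra K A & isCStarAlgebra K A}.

HB.instance Definition _ (K : numClosedFieldType) (A : cstarAlgType K) :=
  GRing.UnitAlgebra.copy (CStarAlgebra.sort A) (BanachAlgebra.sort A).

Section CStarAlgebraDefs.
Context {K : numClosedFieldType} {A : cstarAlgType K}.

(* Star-closure is automatic for closed two-sided ideals of a C*-algebra. *)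
Record closed_ideal (J : set A) : Prop := ClosedIdeal {
  ideal_closed : closed J ;
  ideal0 : J 0 ;
  idealD : forall x y, J x -> J y -> J (x + y) ;
  idealZ : forall (c : K) x, J x -> J (c *: x) ;
  ideal_mull : forall a x, J x -> J (a * x) ;
  ideal_mulr : forall a x, J x -> J (x * a) ;
  ideal_star : forall x, J x -> J (star x)
}.

Definition non_unital (J : set A) : Prop :=
  ~ exists2 e, J e & forall a, J a -> e * a = a /\ a * e = a.

Record star_automorphism := StarAutomorphism {
  aut_fun :> {lrmorphism A -> A} ;
  aut_inv : A -> A ;
  aut_funK : cancel aut_fun aut_inv ;
  aut_invK : cancel aut_inv aut_fun ;
  aut_star : forall a, aut_fun (star a) = star (aut_fun a) ;
  aut_isometric : forall a, `|aut_fun a| = `|a|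
}.

Definition aut_pow (Phi : star_automorphism) (m : int) : A -> A :=
  match m with
  | Posz n => iter n Phi
  | Negz n => iter n.+1 (aut_inv Phi)
  end.

(* Phi^k(b) Phi^(k+1)(b) ... Phi^(k+m-1)(b), in this order; 1 if m = 0 *)
Definition orbit_prod (Phi : star_automorphism) (b : A) (k : int) (m : nat) : A :=
  \prod_(0 <= j < m) aut_pow Phi (k + j%:Z) b.

(* Phi^(m-1)(b^-1) Phi^(m-2)(b^-1) ... Phi(b^-1) b^-1; 1 if m = 0 *)
Definition inv_orbit_prod (Phi : star_automorphism) (b : A) (m : nat) : A :=
  \prod_(0 <= j < m) iter (m - j.+1)%N Phi b^-1.

Definition gen_translation (Phi : star_automorphism) (b : A) : A -> A :=
  fun a => b * Phi a.

Lemma gen_translation_stable (Phi : star_automorphism) (J : set A)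
    (hJ : closed_ideal J) (hPhi : Phi @` J = J) (b a : A) :
  J a -> J (gen_translation Phi b a).
Proof. by move=> Ja; apply: (ideal_mull hJ); rewrite -hPhi; exists a. Qed.

Definition gen_translation_on (Phi : star_automorphism) (J : set A)
    (hJ : closed_ideal J) (hPhi : Phi @` J = J) (b : A) : J -> J :=
  fun a => SigSub (mem_set (gen_translation_stable hJ hPhi b (set_valP a))).

End CStarAlgebraDefs.

Arguments star_automorphism {K} A.

Section Nets.
Context {I : Type} (le : I -> I -> Prop).

Definition directed_preorder : Prop :=
  [/\ inhabited I, forall i, le i i,
      forall i j k, le i j -> le j k -> le i k
    & forall i j, exists2 k, le i k & le j k].

Definition net_filter : set_system I :=
  [set P | exists i0, forall i, le i0 i -> P i].

Definition approximate_unit {K : numClosedFieldType} {A : cstarAlgType K}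
    (J : set A) (u : I -> A) : Prop :=
  (forall i, J (u i)) /\
  forall a, J a ->
    (u i * a @[i --> net_filter] --> a) /\ (a * u i @[i --> net_filter] --> a).

End Nets.

Definition furstenberg_family (F : set (set nat)) : Prop :=
  forall A B : set nat, F A -> A `<=` B -> F B.

Definition proper_family (F : set (set nat)) : Prop := F !=set0 /\ ~ F set0.

Definition finitely_invariant (F : set (set nat)) : Prop :=
  forall (A : set nat) (n : nat), F A -> F (A `\` [set m | (m <= n)%N]).

Definition disjoint_transitive (F : set (set nat)) (X : topologicalType)
    (N : nat) (S : 'I_N -> X -> X) : Prop :=
  forall (O : set X) (V : 'I_N -> set X),
    open O -> O !=set0 -> (forall l, open (V l)) -> (forall l, V l !=set0) ->
    F [set n | O `&` \bigcap_l (iter n (S l) @^-1` V l) !=set0].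

(* Main.v *)
Require Import Defs.
From HB Require Import structures.
From mathcomp Require Import all_boot all_order all_algebra.
From mathcomp Require Import complex.
From mathcomp Require Import all_classical all_reals all_analysis.

Set Implicit Arguments.
Unset Strict Implicit.
Unset Printing Implicit Defensive.

Import Order.TTheory GRing.Theory Num.Theory.
Import numFieldNormedType.Exports.

Local Open Scope classical_set_scope.
Local Open Scope ring_scope.

(** Write [T] for [gen_translation Phi b] and
    [P m := orbit_prod Phi b 0 m = b Phi(b) ... Phi^(m-1)(b)].  Then
    [T^m x = P m * Phi^m x], [inv_orbit_prod Phi b m] is the inverse of [P m],
    and [orbit_prod Phi b k m] is [Phi^k (P m)].  Multiplying [Phi^(t-m) (P m)]
    by [Phi^t z] gives [Phi^(t-m) (T^m z)] ([orbit_prod_translation]), and [Phi]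
    is isometric; so the norms in the analytic condition, which asks for the
    sequences [q] and [d], speak about the orbits of the translations.  Let
    [m l := r l * n].

    From the analytic condition to transitivity ([glue_estimate]): given a
    point [a] of the open set [O] and [c l] in [V l], choose one index [i] such
    that [u := p i ^+ 2] moves none of these points much, and glue them into
    [x := q a + \sum_s z s], where [z s] is the preimage of [d s * c s] under
    [T s ^ (m s)].  The smallness conditions bound the [z s],
    [T l ^ (m l) (q a)] and the cross terms [T l ^ (m l) (z s)], [s != l], so
    that [x] is close to [u a] and [T l ^ (m l) x] to [u (c l)].

    From transitivity to the analytic condition ([cutoff_conditions]): take [x]
    close to [c := p i] whose images [T l ^ (m l) x] are close to [c] as well,
    and put [q := x c], [d l := T l ^ (m l) x * c].  Each product to be
    bounded is then [Phi^k y * c] with [y] close to [c], hence close to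
    [Phi^k c * c]; this vanishes for large [|k|], for negative [k] by taking
    adjoints.  The exponents [k] that occur are [- m l], [m l] and
    [m s - m l], all of modulus at least [n]; finite invariance of the
    family discards the small [n].

    Transitivity yields points [x] that depend on the precision.  They are
    merged into one sequence by using at time [n] the best precision
    [1 / (j + 1)], [j <= n], that is attainable ([diagonal_choice]). *)

(** * Powers of the automorphism and products along its orbits *)

Section Automorphism.
Context {K : numClosedFieldType} {A : cstarAlgType K}.
Implicit Types (Phi : star_automorphism A) (a b x y : A) (k : int) (m t : nat).

Lemma normM_le x y : `|x * y| <= `|x| * `|y|.
Proof. exact: bnorm_submul. Qed.

Lemma star0 : star (0 : A) = 0.
Proof. by apply: (addrI (star 0)); rewrite -starD !addr0. Qed.

Lemma iter_autM Phi m : {morph iter m Phi : x y / x * y}.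
Proof. by elim: m => // m IH x y; rewrite !iterS IH rmorphM. Qed.

Lemma iter_autB Phi m : {morph iter m Phi : x y / x - y}.
Proof. by elim: m => // m IH x y; rewrite !iterS IH rmorphB. Qed.

Lemma iter_aut_star Phi m x : iter m Phi (star x) = star (iter m Phi x).
Proof. by elim: m => // m IH; rewrite !iterS IH aut_star. Qed.

Lemma norm_iter_aut Phi m x : `|iter m Phi x| = `|x|.
Proof. by elim: m => // m IH; rewrite iterS aut_isometric. Qed.

Lemma iter_autK Phi m : cancel (iter m (aut_inv Phi)) (iter m Phi).
Proof. by elim: m => // m IH x; rewrite iterSr iterS aut_invK IH. Qed.

Lemma aut_powS Phi k x : aut_pow Phi (k + 1) x = Phi (aut_pow Phi k x).
Proof.
case: k => [n|[|n]].
- by rewrite (_ : Posz n + 1 = n.+1%:Z) // -addn1 PoszD.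
- by rewrite /= aut_invK.
- rewrite (_ : Negz n.+1 + 1 = Negz n); last first.
    by rewrite !NegzE -[in LHS](addn1 n.+1) PoszD opprD addrNK.
  by rewrite /aut_pow [in RHS]iterS aut_invK.
Qed.

Lemma aut_powDl Phi k m x :
  aut_pow Phi (k + m%:Z) x = iter m Phi (aut_pow Phi k x).
Proof.
elim: m => [|m IH]; first by rewrite addr0.
by rewrite -addn1 PoszD addrA aut_powS IH addn1.
Qed.

Lemma aut_pow_comm Phi k x : aut_pow Phi k (Phi x) = Phi (aut_pow Phi k x).
Proof.
case: k => n; rewrite /aut_pow; first by rewrite -iterSr.
by rewrite iterSr aut_funK [in RHS]iterS aut_invK.
Qed.

Lemma aut_powDr Phi k m x :
  aut_pow Phi (k + m%:Z) x = aut_pow Phi k (iter m Phi x).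
Proof.
by rewrite aut_powDl; elim: m => // m IH; rewrite !iterS aut_pow_comm IH.
Qed.

Lemma iter_aut_inj Phi m : injective (iter m Phi).
Proof.
by elim: m => // m IH x y; rewrite !iterS => /(can_inj (aut_funK Phi))/IH.
Qed.

Lemma aut_powM Phi k : {morph aut_pow Phi k : x y / x * y}.
Proof.
case: k => m x y; first exact: iter_autM.
by apply: (@iter_aut_inj Phi m.+1); rewrite iter_autM !iter_autK.
Qed.

Lemma aut_pow1 Phi k : aut_pow Phi k 1 = 1.
Proof.
have iter1 m : iter m Phi 1 = 1 by elim: m => // m IH; rewrite iterS IH rmorph1.
case: k => m; first exact: iter1.
by apply: (@iter_aut_inj Phi m.+1); rewrite iter_autK iter1.
Qed.

Lemma norm_aut_pow Phi k x : `|aut_pow Phi k x| = `|x|.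
Proof.
case: k => m; first exact: norm_iter_aut.
by rewrite -(norm_iter_aut Phi m.+1) iter_autK.
Qed.

Lemma orbit_prod_shift Phi b k m :
  orbit_prod Phi b k m = aut_pow Phi k (orbit_prod Phi b 0 m).
Proof.
rewrite /orbit_prod (big_morph _ (aut_powM Phi k) (aut_pow1 Phi k)).
by apply: eq_bigr => j _; rewrite add0r aut_powDr.
Qed.

Lemma orbit_prod0S Phi b m :
  orbit_prod Phi b 0 m.+1 = orbit_prod Phi b 0 m * iter m Phi b.
Proof. by rewrite /orbit_prod big_nat_recr //= add0r. Qed.

Lemma inv_orbit_prodS Phi b m :
  inv_orbit_prod Phi b m.+1 = iter m Phi b^-1 * inv_orbit_prod Phi b m.
Proof. by rewrite /inv_orbit_prod big_nat_recl //= subn1. Qed.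

Lemma iter_gen_translation Phi b m x :
  iter m (gen_translation Phi b) x = orbit_prod Phi b 0 m * iter m Phi x.
Proof.
elim: m x => [|m IH] x; first by rewrite /orbit_prod big_geq // mul1r.
by rewrite iterSr IH /gen_translation iter_autM orbit_prod0S mulrA -iterSr.
Qed.

Lemma orbit_prodK Phi b m : b \is a GRing.unit ->
  orbit_prod Phi b 0 m * inv_orbit_prod Phi b m = 1.
Proof.
move=> ub; elim: m => [|m IH].
  by rewrite /orbit_prod /inv_orbit_prod !big_geq // mulr1.
rewrite orbit_prod0S inv_orbit_prodS -mulrA (mulrA (iter m Phi b)) -iter_autM.
by rewrite mulrV // [iter m Phi 1](aut_pow1 Phi m) mul1r.
Qed.

Lemma inv_orbit_prodK Phi b m : b \is a GRing.unit ->
  inv_orbit_prod Phi b m * orbit_prod Phi b 0 m = 1.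
Proof.
move=> ub; elim: m => [|m IH].
  by rewrite /orbit_prod /inv_orbit_prod !big_geq // mulr1.
rewrite orbit_prod0S inv_orbit_prodS mulrA -(mulrA (iter m Phi _)) IH mulr1.
by rewrite -iter_autM mulVr // [iter m Phi 1](aut_pow1 Phi m).
Qed.

(** Every [orbit_prod] of the analytic condition has this form, with [t = 0] or
    [t] the exponent of another translation; its action on [Phi^t z] is an
    iterate of the translation seen through a power of the isometry [Phi]. *)
Lemma orbit_prod_translation Phi b m t z :
  orbit_prod Phi b (t%:Z - m%:Z) m * iter t Phi z =
  aut_pow Phi (t%:Z - m%:Z) (iter m (gen_translation Phi b) z).
Proof.
rewrite orbit_prod_shift iter_gen_translation aut_powM -aut_powDr.
by rewrite subrK.
Qed.

(** For [k = - n] the claim is the adjoint of the hypothesis: [Phi^n] maps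
    [Phi^(-n) c * c] to [c * Phi^n c = star (Phi^n c * c)]. *)
Lemma aut_pow_annihilate Phi c n k : star c = c ->
  iter n Phi c * c = 0 -> `|k|%N = n -> aut_pow Phi k c * c = 0.
Proof.
move=> cs c0; case: k => m /= mn; first by rewrite mn.
apply: (@iter_aut_inj Phi m.+1); rewrite iter_autM iter_autK.
rewrite mn -{1}cs -{2}cs iter_aut_star.
(* [starM] is stated for [bmul], from which the ring product is derived. *)
change (bmul (star c) (star (iter n Phi c)) = iter n Phi 0); rewrite -starM.
rewrite [bmul _ _]c0 star0; elim: (n) => // i IH; by rewrite iterS -IH rmorph0.
Qed.

End Automorphism.

(** * Norm estimates at a single time *)

Section Estimates.
Context {K : numClosedFieldType} {A : cstarAlgType K}.
Implicit Types (Phi : star_automorphism A).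

Lemma normM_le_wpM2r (e : K) (x y : A) : `|x| <= e -> `|x * y| <= e * `|y|.
Proof. by move=> xe; apply: le_trans (normM_le x y) _; rewrite ler_wpM2r. Qed.

(** The analytic condition at a single time and precision, for arbitrary
    exponents [m l] in place of [r l * n]. *)
Definition cutoffs_within Phi (N : nat) (b : 'I_N -> A) (m : 'I_N -> nat)
    (u q : A) (d : 'I_N -> A) (e : K) : Prop :=
  (forall l,
     [/\ `|q - u| < e, `|d l - u| < e,
         `|orbit_prod Phi (b l) (- (m l)%:Z) (m l) * q| < e &
         `|inv_orbit_prod Phi (b l) (m l) * d l| < e]) /\
  (forall l s, l != s ->
     `|orbit_prod Phi (b l) ((m s)%:Z - (m l)%:Z) (m l)
       * inv_orbit_prod Phi (b s) (m s) * d s| < e).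

(** The [s]-th summand of [x] is the preimage of [d s * c s] under
    [T s ^ (m s)]: it is small itself, contributes [d s * c s] to
    [T s ^ (m s) x], and only a small cross term to the other images. *)
Lemma glue_estimate Phi (N : nat) (b : 'I_N -> A) (m : 'I_N -> nat)
    (u q : A) (d : 'I_N -> A) (e : K) (a : A) (c : 'I_N -> A)
    (hN : (0 < N)%N) (hb : forall l, b l \is a GRing.unit)
    (hqd : cutoffs_within Phi b m u q d e) :
  let x := q * a + \sum_s iter (m s) (aut_inv Phi)
                            (inv_orbit_prod Phi (b s) (m s) * d s * c s) in
  `|x - u * a| <= e * (`|a| + \sum_s `|c s|) /\
  forall l, `|iter (m l) (gen_translation Phi (b l)) x - u * c l|
            <= e * (`|a| + \sum_s `|c s|).
Proof.
have [hl hls] := hqd.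
have hq : `|q - u| <= e by have [/ltW] := hl (Ordinal hN).
have hd l : `|d l - u| <= e by have [_ /ltW] := hl l.
pose z s := iter (m s) (aut_inv Phi)
  (inv_orbit_prod Phi (b s) (m s) * d s * c s).
have Phiz s : iter (m s) Phi (z s) = inv_orbit_prod Phi (b s) (m s) * d s * c s.
  exact: iter_autK.
move=> x; rewrite mulrDr mulr_sumr; split=> [|l].
  rewrite (_ : x - u * a = (q - u) * a + \sum_s z s); last first.
    by rewrite mulrBl addrAC.
  apply: le_trans (ler_normD _ _) _; apply: lerD; first exact: normM_le_wpM2r.
  apply: le_trans (ler_norm_sum _ _ _) _; apply: ler_sum => s _.
  rewrite -(norm_iter_aut Phi (m s)) Phiz; apply: normM_le_wpM2r.
  by have [_ _ _ /ltW] := hl s.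
have TD : {morph iter (m l) (gen_translation Phi (b l)) : y z / y + z}.
  elim: (m l) => // i IH y y'.
  by rewrite !iterS IH /gen_translation rmorphD mulrDr.
have T0 : iter (m l) (gen_translation Phi (b l)) 0 = 0.
  by apply: (addrI (iter (m l) (gen_translation Phi (b l)) 0)); rewrite -TD !addr0.
rewrite /x TD (big_morph _ TD T0) (bigD1 l) //= [X in _ <= _ + X](bigD1 l) //=.
have -> : iter (m l) (gen_translation Phi (b l)) (z l) = d l * c l.
  by rewrite iter_gen_translation Phiz !mulrA orbit_prodK // mul1r.
rewrite (_ : _ - u * c l = iter (m l) (gen_translation Phi (b l)) (q * a) +
   ((d l - u) * c l +
    \sum_(s < N | s != l) iter (m l) (gen_translation Phi (b l)) (z s))); last first.
  by rewrite mulrBl -addrA; congr (_ + _); rewrite addrAC.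
apply: le_trans (ler_normD _ _) _; apply: lerD.
  rewrite -(norm_aut_pow Phi (0%:Z - (m l)%:Z)) -orbit_prod_translation sub0r.
  rewrite mulrA; apply: normM_le_wpM2r.
  by have [_ _ /ltW] := hl l.
apply: le_trans (ler_normD _ _) _; apply: lerD; first exact: normM_le_wpM2r.
apply: le_trans (ler_norm_sum _ _ _) _; apply: ler_sum => s sl.
rewrite -(norm_aut_pow Phi ((m s)%:Z - (m l)%:Z)) -orbit_prod_translation Phiz.
by rewrite !mulrA; apply: normM_le_wpM2r; apply/ltW/hls; rewrite eq_sym.
Qed.

(** [c] annihilates [Phi^k c], so what survives of [Phi^k y] after
    multiplication by [c] comes from [y - c]. *)
Lemma cutoff_estimate Phi (c y : A) k (e : K) :
  `|c| <= 1 -> `|y - c| < e -> aut_pow Phi k c * c = 0 ->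
  `|aut_pow Phi k y * c| < e.
Proof.
move=> c1 yc c0.
rewrite -[X in `|X|]subr0 -c0 -mulrBl.
apply: le_lt_trans (normM_le _ _) _.
have -> : `|aut_pow Phi k y - aut_pow Phi k c| = `|y - c|.
  case: k {c0} => m; first by rewrite -iter_autB norm_iter_aut.
  by rewrite -(norm_iter_aut Phi m.+1) iter_autB !iter_autK.
by apply: le_lt_trans yc; rewrite ler_piMr.
Qed.

Lemma cutoff_near_square (c y : A) (e : K) :
  `|c| <= 1 -> `|y - c| < e -> `|y * c - c ^+ 2| < e.
Proof.
move=> c1 yc; rewrite expr2 -mulrBl; apply: le_lt_trans (normM_le _ _) _.
by apply: le_lt_trans yc; rewrite ler_piMr.
Qed.

(** Each product in the analytic condition reduces to [Phi^k y * c], where [y]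
    is [x] or one of its images, to which [cutoff_estimate] applies. *)
Lemma cutoff_conditions Phi (N : nat) (b : 'I_N -> A) (m : 'I_N -> nat)
    (c x : A) (e : K) (N0 : nat)
    (hb : forall l, b l \is a GRing.unit)
    (hcs : star c = c) (hc1 : `|c| <= 1)
    (hc : forall n, (N0 <= n)%N -> iter n Phi c * c = 0)
    (hm : forall l, (N0 <= m l)%N)
    (hms : forall l s, l != s -> (N0 <= `|(m s)%:Z - (m l)%:Z|)%N)
    (hx : `|x - c| < e)
    (hTx : forall l, `|iter (m l) (gen_translation Phi (b l)) x - c| < e) :
  let q := x * c in
  let d l := iter (m l) (gen_translation Phi (b l)) x * c in
  cutoffs_within Phi b m (c ^+ 2) q d e.
Proof.
have hk k : (N0 <= `|k|)%N -> aut_pow Phi k c * c = 0.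
  by move=> /hc ck; exact: aut_pow_annihilate ck _.
move=> q d.
have Pd l : inv_orbit_prod Phi (b l) (m l) * d l = iter (m l) Phi x * c.
  by rewrite /d iter_gen_translation !mulrA inv_orbit_prodK // mul1r.
split=> [l|l s ls].
  split; [by apply: cutoff_near_square|by apply: cutoff_near_square| |].
    rewrite mulrA -(sub0r (m l)%:Z) (orbit_prod_translation _ _ _ 0).
    by apply: cutoff_estimate => //; apply: hk; rewrite sub0r abszN; exact: hm.
  rewrite Pd; apply: (@cutoff_estimate Phi c x (m l)%:Z) => //.
  by apply: hk; exact: hm.
rewrite -mulrA Pd mulrA orbit_prod_translation.
by apply: cutoff_estimate => //; apply: hk; apply: hms.
Qed.

End Estimates.

(** * Approximation and the topology of the ideal *)

(** A positive [e] in [R[i]] is real, so the Archimedean property of [R]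
    applies. *)
Lemma near_invS (R : realType) (e : R[i]) : 0 < e ->
  \forall j \near \oo, j.+1%:R^-1 < e.
Proof.
rewrite ltcE => /andP[/eqP ie re].
have eE : e = ((complex.Re e)%:C)%C by case: (e) ie => x y /= ->.
near=> j.
have : j.+1%:R^-1 < complex.Re e.
  by near: j; exact: (near_infty_natSinv_lt (PosNum re)).
by rewrite -ltcR -eE fmorphV rmorph_nat.
Unshelve. all: by end_near. Qed.

Lemma net_filter_filter (I : Type) (le : I -> I -> Prop) :
  directed_preorder le -> ProperFilter (net_filter le).
Proof.
move=> [[i0] refl trans dir]; split=> [[i /(_ i (refl i))] //|]; split.
- by exists i0.
- move=> P Q [i Pi] [j Qj]; have [k ik jk] := dir i j; exists k => l kl.
  by split; [apply: Pi; apply: trans kl|apply: Qj; apply: trans kl].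
- by move=> P Q PQ [i Pi]; exists i => j ij; apply/PQ/Pi.
Qed.

Lemma approximate_unit_finite (K : numClosedFieldType) (A1 : cstarAlgType K)
    (A : set A1) (I : Type) (le : I -> I -> Prop) (u : I -> A1)
    (J : finType) (y : J -> A1) (e : K) :
  directed_preorder le -> approximate_unit le A u ->
  (forall j, A (y j)) -> 0 < e ->
  exists i, forall j, `|u i * y j - y j| < e.
Proof.
move=> /net_filter_filter FF [_ uau] Ay e0.
apply: (@filter_ex _ (net_filter le)).
apply: (@filter_forall _ _ (fun j i => `|u i * y j - y j| < e)
  (net_filter le) _) => j.
have /cvgrPdist_lt/(_ e e0) := (uau _ (Ay j)).1.
by apply: filterS => i; rewrite distrC.
Qed.

(** The radii are the [1 / (j + 1)] with large [j], rather than one positive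
    number, so that finitely many open sets get a common radius by intersecting
    neighbourhoods of infinity. *)
Lemma open_near_ball (R : realType) (A1 : cstarAlgType R[i]) (A : set A1)
    (O : set A) (x : A) : open O -> O x ->
  \forall j \near \oo, forall y : A, `|val y - val x| < j.+1%:R^-1 -> O y.
Proof.
move=> [U oU <-] Ux.
have : nbhs (val x) U by exact: open_nbhs_nbhs.
move=> /nbhs_normP[e /= e0 xeU].
near=> j => y yx; apply: xeU => /=; rewrite distrC; apply: lt_trans yx _.
by near: j; exact: near_invS.
Unshelve. all: by end_near. Qed.

Lemma open_set_type_ball (K : numClosedFieldType) (A1 : cstarAlgType K)
    (A : set A1) (c : A1) (e : K) : open [set x : A | `|val x - c| < e].
Proof.
exists (ball c e); first exact: ball_open.
by apply/seteqP; split=> x; rewrite /= -ball_normE /= distrC.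
Qed.

(** [G j n] is a demand of strength [j] at time [n].  Only the demands [j <= n]
    are considered at time [n], so there is a strongest satisfiable one; any
    solution of it solves the weaker ones too. *)
Lemma diagonal_choice (X : Type) (x0 : X) (G : nat -> nat -> X -> Prop) :
  (forall j n x, G j.+1 n x -> G j n x) ->
  exists x : nat -> X,
    forall n j, (j <= n)%N -> (exists y, G j n y) -> G j n (x n).
Proof.
move=> GS; suff H n k : exists x, forall j, (j <= k)%N ->
    (exists y, G j n y) -> G j n x.
  have [x Hx] := choice (fun n => H n n).
  by exists x.
have Gle j i x : (j <= i)%N -> G i n x -> G j n x.
  elim: i => [|i IH]; first by rewrite leqn0 => /eqP ->.
  by rewrite leq_eqVlt => /predU1P[->//|/IH{}IH /GS].
elim: k => [|k [x Hx]].
  have [[y Gy]|nG] := pselect (exists y, G 0%N n y).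
    by exists y => j; rewrite leqn0 => /eqP ->.
  by exists x0 => j; rewrite leqn0 => /eqP -> /nG.
have [[y Gy]|nG] := pselect (exists y, G k.+1 n y).
  by exists y => j jk _; apply: Gle Gy.
by exists x => j; rewrite leq_eqVlt => /predU1P[-> /nG//|]; apply: Hx.
Qed.

Lemma val_iter_translation (K : numClosedFieldType) (A1 : cstarAlgType K)
    (A : set A1) (hA : closed_ideal A) (Phi : star_automorphism A1)
    (hPhi : Phi @` A = A) (b : A1) (r n : nat) (x : A) :
  val (iter n (iter r (gen_translation_on hA hPhi b)) x) =
  iter (r * n) (gen_translation Phi b) (val x).
Proof. by rewrite mulnC -iterM; elim: (n * r)%N => // m IH; rewrite !iterS -IH. Qed.

Lemma ideal_iter_aut_inv (K : numClosedFieldType) (A1 : cstarAlgType K)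
    (A : set A1) (Phi : star_automorphism A1) (hPhi : Phi @` A = A) m x :
  A x -> A (iter m (aut_inv Phi) x).
Proof.
move=> Ax; elim: m => // m; rewrite iterS -{1}hPhi => -[y Ay <-].
by rewrite aut_funK.
Qed.

(** * The two implications *)

Section Equivalence.
Context {R : realType} {A1 : cstarAlgType R[i]} {A : set A1}
  (hA : closed_ideal A) {Phi : star_automorphism A1} (hPhi : Phi @` A = A)
  {N : nat} {b : 'I_N -> A1} (hb : forall l, b l \is a GRing.unit)
  {F : set (set nat)} (hF : furstenberg_family F) {r : 'I_N -> nat}.

Local Notation S := (fun l => iter (r l) (gen_translation_on hA hPhi (b l))).

Definition cutoff_sequences (u : A1) : Prop :=
  exists (q : nat -> A1) (d : 'I_N -> nat -> A1),
    [/\ forall n, A (q n), forall l n, A (d l n) &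
    forall e : R[i], 0 < e -> exists2 Fe : set nat, F Fe &
    forall n : nat, Fe n ->
      cutoffs_within Phi b (fun l => r l * n)%N u (q n) (d^~ n) e].

(** A single index of the approximate unit serves the centres of all the open
    sets.  With [M] the sum of their norms, gluing costs [e * M], which the
    choice of [e] keeps below half of the common radius [eta]. *)
Lemma transitive_of_cutoff {I : Type} {le : I -> I -> Prop}
    (hI : directed_preorder le) (u : I -> A1) (hu : approximate_unit le A u) :
  (0 < N)%N -> (forall i, cutoff_sequences (u i)) -> disjoint_transitive F S.
Proof.
move=> N0 hqd O V oO [a Oa] oV V0.
have /choice[c Vc] : forall l, exists y, V l y by [].
have [j [Oj Vj]] : exists j : nat,
    (forall y : A, `|val y - val a| < j.+1%:R^-1 -> O y) /\
    (forall l (y : A), `|val y - val (c l)| < j.+1%:R^-1 -> V l y).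
  apply: (@filter_ex _ \oo); apply: filterI; first exact: open_near_ball.
  apply: (@filter_forall _ _ (fun l j => forall y : A,
    `|val y - val (c l)| < j.+1%:R^-1 -> V l y) \oo _) => l.
  exact: open_near_ball.
pose eta : R[i] := j.+1%:R^-1.
have eta2 : 0 < eta / 2 by rewrite divr_gt0 // invr_gt0.
have [i ui] := @approximate_unit_finite _ _ A I le u (option 'I_N)
  (fun o => if o is Some l then val (c l) else val a) (eta / 2) hI hu
  (fun o => if o is Some l return A (if o is Some l then val (c l) else val a)
            then set_valP (c l) else set_valP a) eta2.
pose M : R[i] := `|val a| + \sum_s `|val (c s)|.
have M0 : 0 <= M by rewrite addr_ge0 ?sumr_ge0.
have M1 : 0 < M + 1 by rewrite ltr_wpDl.
(* [M + 1] instead of [M] because all the centres may vanish. *)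
pose e := eta / 2 / (M + 1).
have e0 : 0 < e by rewrite divr_gt0.
have eM : e * M <= eta / 2.
  by rewrite mulrAC ler_pdivrMr // ler_wpM2l ?(ltW eta2) // lerDl.
have [q [d [Aq Ad /(_ e e0)[Fe FFe hFe]]]] := hqd i.
apply: hF FFe _ => n /hFe hn /=.
pose x := q n * val a + \sum_s iter (r s * n) (aut_inv Phi)
  (inv_orbit_prod Phi (b s) (r s * n) * d s n * val (c s)).
have [xa xc] := glue_estimate (val a) (fun s => val (c s)) N0 hb hn.
have close y v : `|y - u i * v| <= e * M -> `|u i * v - v| < eta / 2 ->
    `|y - v| < eta.
  move=> yv uv; rewrite -(subrKA (u i * v)) (splitr eta).
  apply: le_lt_trans (ler_normD _ _) _.
  by apply: ler_ltD => //; apply: le_trans yv eM.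
have Ax : A x.
  apply: (idealD hA); first exact: ideal_mulr.
  apply: (big_ind A); [exact: ideal0|exact: idealD|move=> s _].
  apply: ideal_iter_aut_inv => //; apply: (ideal_mull hA); exact: set_valP.
exists (SigSub (mem_set Ax)); split.
  by apply: Oj; apply: close => //; exact: (ui None).
move=> l _; apply: Vj; rewrite val_iter_translation.
by apply: close; [exact: xc|exact: (ui (Some l))].
Qed.

(** Transitivity is used for the balls [B j] of radius [1 / (j + 1)] about [c],
    taken both as [O] and as every [V l]. *)
Lemma cutoff_of_transitive (hFi : finitely_invariant F)
    (hr0 : forall l, (0 < r l)%N)
    (hr : forall l s : 'I_N, l != s -> r l != r s)
    (c : A1) (hcA : A c) (hcs : star c = c) (hc1 : `|c| <= 1)
    (hc : exists N0 : nat, forall n : nat, (N0 <= n)%N -> iter n Phi c * c = 0) :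
  disjoint_transitive F S -> cutoff_sequences (c ^+ 2).
Proof.
move=> hT; have [N0 hN0] := hc.
pose cA : A := SigSub (mem_set hcA).
pose B j := [set x : A | `|val x - c| < j.+1%:R^-1].
pose G j n x := (B j `&` \bigcap_l (iter n (S l) @^-1` B j)) x.
have BS j : B j.+1 `<=` B j.
  by move=> x /lt_trans; apply; rewrite ltf_pV2 ?posrE ?ltr_nat.
have [x xG] : exists x : nat -> A,
    forall n j, (j <= n)%N -> (exists y, G j n y) -> G j n (x n).
  apply: (diagonal_choice cA) => j n y [By Ty]; split; first exact: BS.
  by move=> l Il; apply: BS; exact: Ty.
exists (fun n => val (x n) * c).
exists (fun l n => iter (r l * n) (gen_translation Phi (b l)) (val (x n)) * c).
split=> [n|l n|e e0]; [exact: ideal_mull|exact: ideal_mull|].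
have [j je] : exists j, j.+1%:R^-1 < e by apply: filter_ex (near_invS e0).
have B0 : B j !=set0 by exists cA; rewrite /B /= subrr normr0 invr_gt0.
have oB : open (B j) by exact: open_set_type_ball.
(* Times up to [j] are removed for the diagonal choice, times up to [N0] for
   the products [Phi^k c * c] to vanish. *)
exists ([set n | B j `&` \bigcap_l (iter n (S l) @^-1` B j) !=set0]
        `\` [set n | (n <= maxn j N0)%N]).
  by apply: hFi; apply: hT.
move=> n [Gn /negP]; rewrite -ltnNge gtn_max => /andP[/ltnW jn /ltnW N0n].
have [Bx Tx] := xG n j jn Gn.
have N0M k : (0 < k)%N -> (N0 <= k * n)%N.
  by move=> k0; apply: leq_trans N0n _; rewrite leq_pmull.
apply: (cutoff_conditions hb hcs hc1 hN0).
- by move=> l; apply: N0M.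
- move=> l s ls; rewrite !PoszM -mulrBl abszM; apply: N0M.
  by rewrite absz_gt0 subr_eq0 eqz_nat eq_sym hr.
- exact: lt_trans Bx je.
- by move=> l; rewrite -val_iter_translation; exact: lt_trans (Tx l I) je.
Qed.

End Equivalence.

Theorem theorem3p5 (R : realType) (A1 : cstarAlgType R[i]) (A : set A1)
    (hA : closed_ideal A) (hAnu : non_unital A)
    (Phi : star_automorphism A1) (hPhi : Phi @` A = A)
    (I : Type) (le : I -> I -> Prop) (hI : directed_preorder le)
    (p : I -> A1)
    (hpA : forall i, A (p i))
    (hpsa : forall i, star (p i) = p i)
    (hp1 : forall i, `|p i| <= 1)
    (hpau : approximate_unit le A (fun i => p i ^+ 2))
    (hpN : forall i, exists N0 : nat, forall n : nat, (N0 <= n)%N ->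
       iter n Phi (p i) * p i = 0)
    (N : nat) (hN : (2 <= N)%N)
    (b : 'I_N -> A1) (hb : forall l, b l \is a GRing.unit)
    (F : set (set nat)) (hF : furstenberg_family F)
    (hFp : proper_family F) (hFi : finitely_invariant F)
    (r : 'I_N -> nat) (hr0 : forall l, (0 < r l)%N)
    (hr : forall l s : 'I_N, (l < s)%N -> (r l < r s)%N) :
  disjoint_transitive F
    (fun l => iter (r l) (gen_translation_on hA hPhi (b l)))
  <->
  forall i : I, exists (q : nat -> A1) (d : 'I_N -> nat -> A1),
    [/\ forall n, A (q n), forall l n, A (d l n) &
    forall e : R[i], 0 < e -> exists2 Fe : set nat, F Fe &
    forall n : nat, Fe n ->
      (forall l : 'I_N,
         [/\ `|q n - p i ^+ 2| < e,
             `|d l n - p i ^+ 2| < e,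
             `|orbit_prod Phi (b l) (- (r l * n)%:Z) (r l * n) * q n| < e &
             `|inv_orbit_prod Phi (b l) (r l * n) * d l n| < e]) /\
      (forall l s : 'I_N, l != s ->
         `|orbit_prod Phi (b l) ((r s * n)%:Z - (r l * n)%:Z) (r l * n)
           * inv_orbit_prod Phi (b s) (r s * n) * d s n| < e)].
Proof.
split=> [hT i|h2].
  have r_inj l s : l != s -> r l != r s.
    by rewrite -val_eqE !neq_ltn => /orP[] /hr ->; rewrite ?orbT.
  exact: (cutoff_of_transitive hb hFi hr0 r_inj (hpA i) (hpsa i) (hp1 i)
    (hpN i) hT).
exact: (transitive_of_cutoff hA hPhi hb hF hI hpau (ltnW hN) h2).
Qed.
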